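(* Let $\lambda$ be a nonzero real number. For every integer $n\ge 0$, $$D_{n,\lambda}=\frac{1}{n+1}\sum_{m=1}^{n+1}\lambda^{m-1}S_{1}(n+1,m).$$
   Context: Generating functions are power series in $t$ (formal, or convergent for $|t|$ small), with $(1+t)^{x}=\sum_{n\ge 0}(x)_n\frac{t^n}{n!}$, where $(x)_0=1$ and $(x)_n=x(x-1)\cdots(x-n+1)$ for $n\ge1$. The degenerate logarithm is $\log_\lambda(1+t)=\frac{1}{\lambda}\left((1+t)^\lambda-1\right)$. The degenerate Daehee polynomials $D_{n,\lambda}(x)$ are defined by $\frac{\log_\lambda(1+t)}{t}(1+t)^x=\sum_{n=0}^\infty D_{n,\lambda}(x)\frac{t^n}{n!}$, and the degenerate Daehee numbers are $D_{n,\lambda}=D_{n,\lambda}(0)$. The (signed) Stirling numbers of the first kind $S_1(n,l)$ are defined by $(x)_n=\sum_{l=0}^n S_1(n,l)x^l$ for $n\ge 0$. *)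

(* Defs.v *)
From HB Require Import structures.
From mathcomp Require Import all_boot all_order all_algebra.
Set Implicit Arguments.
Unset Strict Implicit.
Unset Printing Implicit Defensive.
Import Order.TTheory GRing.Theory Num.Theory.
Local Open Scope ring_scope.

(* (x)_n = x (x - 1) ... (x - n + 1), in any commutative ring: it is used both
   for real x and for the indeterminate of {poly int}. *)
Definition falling (A : comNzRingType) (x : A) (n : nat) : A :=
  \prod_(i < n) (x - i%:R).

(* The identity (x)_n = \sum_l S_1(n,l) x^l is one of polynomials in x;
   stirling1P below is its evaluated form. *)
Definition stirling1 (n l : nat) : int := (falling ('X : {poly int}) n)`_l.

(* A formal power series is represented by its coefficients: f stands for
   \sum_n f n t^n. *)
Definition fps (F : numFieldType) := nat -> F.

Definition fps_one (F : numFieldType) : fps F := fun n => (n == 0%N)%:R.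

Definition fps_t (F : numFieldType) : fps F := fun n => (n == 1%N)%:R.

Definition fps_sub (F : numFieldType) (f g : fps F) : fps F :=
  fun n => f n - g n.

Definition fps_scale (F : numFieldType) (c : F) (f : fps F) : fps F :=
  fun n => c * f n.

Definition fps_mul (F : numFieldType) (f g : fps F) : fps F :=
  fun n => \sum_(i < n.+1) f i * g (n - i)%N.

(* f / t, meaningful when f has no constant term; see fps_divtK. *)
Definition fps_divt (F : numFieldType) (f : fps F) : fps F := fun n => f n.+1.

(* \sum_n a_n t^n / n! *)
Definition egf (F : numFieldType) (a : nat -> F) : fps F :=
  fun n => a n / n`!%:R.

(* (1 + t)^x *)
Definition binom_fps (F : numFieldType) (x : F) : fps F := egf (falling x).

(* log_lambda (1 + t) = ((1 + t)^lambda - 1) / lambda *)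
Definition deg_log (F : numFieldType) (lambda : F) : fps F :=
  fps_scale lambda^-1 (fps_sub (binom_fps lambda) (fps_one F)).

(* n! times the coefficient of t^n in (log_lambda (1 + t) / t) (1 + t)^x;
   by deg_daehee_polyP and egf_inj this is the only sequence having that
   exponential generating function. *)
Definition deg_daehee_poly (F : numFieldType) (lambda : F) (n : nat) (x : F)
    : F :=
  n`!%:R * fps_mul (fps_divt (deg_log lambda)) (binom_fps x) n.

Definition deg_daehee (F : numFieldType) (lambda : F) (n : nat) : F :=
  deg_daehee_poly lambda n 0.

Lemma stirling1P (A : comNzRingType) (x : A) (n : nat) :
  falling x n = \sum_(0 <= l < n.+1) (stirling1 n l)%:~R * x ^+ l.
Proof.
have cx : commr_rmorph (intmul (1 : A)) x by move=> a; apply: mulrC.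
have -> : falling x n = horner_morph cx (falling 'X n).
  rewrite /falling rmorph_prod; apply: eq_bigr => i _.
  by rewrite rmorphB /= horner_morphX rmorph_nat.
have sz : (size (map_poly (intmul (1 : A)) (falling 'X n)) <= n.+1)%N.
  apply: leq_trans (size_poly _ _) _.
  rewrite /falling (eq_bigr (fun i : 'I_n => 'X - (i%:R : int)%:P)).
    by rewrite size_prod_XsubC /index_enum -enumT size_enum_ord.
  by move=> i _; rewrite polyC_natr.
rewrite /horner_morph (horner_coef_wide _ sz) big_mkord.
by apply: eq_bigr => i _; rewrite coef_map.
Qed.

Lemma fps_divtK (F : numFieldType) (f : fps F) :
  f 0%N = 0 -> fps_mul (fps_t F) (fps_divt f) =1 f.
Proof.
move=> f0 [|n]; rewrite /fps_mul /fps_divt /fps_t.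
  by rewrite big_ord1 mul0r f0.
rewrite 2!big_ord_recl big1 => [|i _]; last by rewrite mul0r.
by rewrite /= mul0r mul1r add0r addr0 /bump /= subSS subn0.
Qed.

Lemma deg_log0 (F : numFieldType) (lambda : F) : deg_log lambda 0%N = 0.
Proof.
rewrite /deg_log /fps_scale /fps_sub /binom_fps /egf /falling /fps_one.
by rewrite big_ord0 divr1 subrr mulr0.
Qed.

Lemma egf_inj (F : numFieldType) (a b : nat -> F) : egf a =1 egf b -> a =1 b.
Proof.
move=> ab n; have := ab n; apply: mulIf.
by rewrite invr_eq0 pnatr_eq0 -lt0n fact_gt0.
Qed.

Lemma deg_daehee_polyP (F : numFieldType) (lambda x : F) :
  fps_mul (fps_divt (deg_log lambda)) (binom_fps x)
  =1 egf (fun n => deg_daehee_poly lambda n x).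
Proof.
by move=> n; rewrite /egf mulrC mulKf // pnatr_eq0 -lt0n fact_gt0.
Qed.

(* Main.v *)
Require Import Defs.
From HB Require Import structures.
From mathcomp Require Import all_boot all_order all_algebra.
From mathcomp Require Import reals.
Set Implicit Arguments.
Unset Strict Implicit.
Unset Printing Implicit Defensive.
Import Order.TTheory GRing.Theory Num.Theory.
Local Open Scope ring_scope.

(** At x = 0 the factor (1 + t)^x is the series 1, so the n-th degenerate
    Daehee number is n! times the coefficient of t^(n+1) in
    ((1 + t)^lambda - 1) / lambda, that is
    n! (lambda)_(n+1) / (lambda (n+1)!) = (lambda)_(n+1) / ((n+1) lambda)
    ([deg_daehee_falling]).  Expanding the falling factorial in powers of
    lambda, the constant term vanishes because (x)_(n+1) is divisible by x
    ([stirling1_S0]), and dividing the other terms by lambda lowers each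
    exponent by one. *)

Lemma falling0S (A : comNzRingType) (n : nat) : falling (0 : A) n.+1 = 0.
Proof. by rewrite /falling big_ord_recl subrr mul0r. Qed.

Lemma stirling1_S0 (n : nat) : stirling1 n.+1 0 = 0.
Proof. by rewrite /stirling1 /falling big_ord_recl subr0 coefXM. Qed.

Lemma binom_fps0 (F : numFieldType) : binom_fps (0 : F) =1 @fps_one F.
Proof.
case=> [|n]; rewrite /binom_fps /egf /fps_one /=.
  by rewrite /falling big_ord0 divr1.
by rewrite falling0S mul0r.
Qed.

Lemma fps_mulr1 (F : numFieldType) (f g : fps F) :
  g =1 @fps_one F -> fps_mul f g =1 f.
Proof.
move=> g1 n; rewrite /fps_mul big_ord_recr big1 /= => [|i _].
  by rewrite subnn g1 mulr1 add0r.
by rewrite g1 /fps_one subn_eq0 leqNgt ltn_ord mulr0.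
Qed.

(** Dividing by t shifts the coefficients by one; this leaves the quotient
    n! / (n+1)! = 1 / (n+1) and moves the series past its constant term, so
    that the subtracted 1 has no effect. *)
Lemma deg_daehee_falling (F : numFieldType) (lambda : F) (n : nat) :
  deg_daehee lambda n = n.+1%:R^-1 * (lambda^-1 * falling lambda n.+1).
Proof.
rewrite /deg_daehee /deg_daehee_poly (fps_mulr1 _ (@binom_fps0 F)).
rewrite /fps_divt /deg_log /fps_scale /fps_sub /binom_fps /egf /fps_one subr0.
have n0 : n`!%:R != 0 :> F by rewrite pnatr_eq0 -lt0n fact_gt0.
rewrite factS natrM invfM 3!(mulrCA n`!%:R) divff // mulr1.
by rewrite mulrA mulrC.
Qed.

Theorem theorem2p1 (R : realType) (lambda : R) (hlambda : lambda != 0)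
    (n : nat) :
  deg_daehee lambda n =
  n.+1%:R^-1 *
    \sum_(1 <= m < n.+2) lambda ^+ (m - 1)%N * (stirling1 n.+1 m)%:~R.
Proof.
rewrite deg_daehee_falling stirling1P big_nat_recl // stirling1_S0 mul0r add0r.
rewrite big_add1 /= mulr_sumr; congr (_ * _); apply: eq_bigr => m _.
by rewrite subn1 /= exprS mulrCA mulKf // mulrC.
Qed.
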